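(* Let $\mathcal{H}_1$ and $\mathcal{H}_2$ be two real Hilbert spaces, let $p,r\ge 1$ be integers, let $B_i:\mathcal{H}_1\to 2^{\mathcal{H}_1}$ ($1\le i\le p$) and $F_j:\mathcal{H}_2\to 2^{\mathcal{H}_2}$ ($1\le j\le r$) be set-valued maximal monotone mappings, and let $A_j:\mathcal{H}_1\to\mathcal{H}_2$ ($1\le j\le r$) be bounded linear operators with adjoints $A_j^*$. Let $$\Gamma_{p,r}:=\{x\in\mathcal{H}_1\mid 0\in B_i(x)\ \text{for all } 1\le i\le p\ \text{and}\ 0\in F_j(A_j(x))\ \text{for all } 1\le j\le r\}.$$ Let $\lambda>0$, $L=p+\sum_{j=1}^r\|A_j\|^2$ and $\gamma\in(0,2/L)$. If $\Gamma_{p,r}\neq\emptyset$, then for every starting point $x^0\in\mathcal{H}_1$ the sequence $\{x^k\}_{k=0}^\infty$ generated by $$x^{k+1}=x^k+\gamma\left(\sum_{i=1}^p\left(J_\lambda^{B_i}(x^k)-x^k\right)+\sum_{j=1}^r A_j^*(J_\lambda^{F_j}-I)A_j(x^k)\right),\qquad k\ge 0,$$ converges weakly to a point $x^*\in\Gamma_{p,r}$.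
   Context: A set-valued mapping $B:\mathcal{H}\to 2^{\mathcal{H}}$ on a real Hilbert space $\mathcal{H}$ is monotone if $\langle u-v,x-y\rangle\ge 0$ for all $u\in B(x)$ and $v\in B(y)$; it is maximal monotone if it is monotone and its graph $G(B)=\{(x,u)\in\mathcal{H}\times\mathcal{H}\mid u\in B(x)\}$ is not properly contained in the graph of any other monotone mapping. For $\lambda>0$ the resolvent of $B$ is $J_\lambda^B:=(I+\lambda B)^{-1}$, where $I$ is the identity operator; it is well known that for maximal monotone $B$ it is single-valued and defined on all of $\mathcal{H}$. *)

(* Defs.v *)
From HB Require Import structures.
From mathcomp Require Import all_boot all_order all_algebra.
From mathcomp Require Import all_classical all_reals all_analysis.

Set Implicit Arguments.
Unset Strict Implicit.
Unset Printing Implicit Defensive.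

Import Order.TTheory GRing.Theory Num.Theory.
Import numFieldNormedType.Exports.

Local Open Scope classical_set_scope.
Local Open Scope ring_scope.

(* Over a real scalar field, [{dot H for idfun}] is the type of symmetric
   positive definite bilinear forms on H. *)
HB.mixin Record CompleteNormedModule_isHilbert (R : realType) H
    of CompleteNormedModule R H := {
  inner : {dot H for idfun};
  sqr_norm_inner : forall x : H, `|x| ^+ 2 = inner x x
}.

#[short(type="hilbertType")]
HB.structure Definition Hilbert (R : realType) :=
  { H of CompleteNormedModule R H & CompleteNormedModule_isHilbert R H }.

Arguments inner {R s}.

Definition weak_cvg (R : realType) (H : hilbertType R)
    (x : nat -> H) (l : H) : Prop :=
  forall y : H, (fun k => inner (x k) y) @ \oo --> inner l y.

Definition bounded_operator (R : realType) (H1 H2 : hilbertType R)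
    (A : H1 -> H2) : Prop :=
  exists M : R, forall x : H1, `|A x| <= M * `|x|.

(* [sup] is real-valued: this is the operator norm for bounded A only. *)
Definition operator_norm (R : realType) (H1 H2 : hilbertType R)
    (A : H1 -> H2) : R :=
  sup [set `|A x| | x in [set x : H1 | `|x| <= 1]].

(* For A bounded linear the set below is a singleton, by the Riesz
   representation theorem; the default value 0 of [xget] is then irrelevant. *)
Definition adjoint (R : realType) (H1 H2 : hilbertType R)
    (A : H1 -> H2) (y : H2) : H1 :=
  xget 0 [set z : H1 | forall x : H1, inner (A x) y = inner x z].

Definition graph (R : realType) (H : hilbertType R) (B : H -> set H) :
    set (H * H) :=
  [set xu | B xu.1 xu.2].

Definition monotone_map (R : realType) (H : hilbertType R)
    (B : H -> set H) : Prop :=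
  forall x y u v : H, B x u -> B y v -> 0 <= inner (u - v) (x - y).

Definition maximal_monotone (R : realType) (H : hilbertType R)
    (B : H -> set H) : Prop :=
  monotone_map B /\
  forall C : H -> set H, monotone_map C -> ~ graph B `<` graph C.

(* The set-valued mapping I + lambda B. *)
Definition id_add_scale (R : realType) (H : hilbertType R) (lambda : R)
    (B : H -> set H) (z : H) : set H :=
  [set z + lambda *: u | u in B z].

Definition inverse_map (R : realType) (H : hilbertType R)
    (B : H -> set H) (x : H) : set H :=
  [set z | B z x].

(* The set-valued inverse is everywhere a singleton when B is maximal monotone
   and lambda > 0 (Minty), so that the default value 0 of [xget] is then
   irrelevant. *)
Definition resolvent (R : realType) (H : hilbertType R) (lambda : R)
    (B : H -> set H) (x : H) : H :=
  xget 0 (inverse_map (id_add_scale lambda B) x).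

Definition common_null_points (R : realType) (H1 H2 : hilbertType R)
    (p r : nat) (B : 'I_p -> H1 -> set H1) (F : 'I_r -> H2 -> set H2)
    (A : 'I_r -> H1 -> H2) : set H1 :=
  [set x | (forall i, B i x 0) /\ (forall j, F j (A j x) 0)].

(* Main.v *)
Require Import Defs.
From HB Require Import structures.
From mathcomp Require Import all_boot all_order all_algebra.
From mathcomp Require Import all_classical all_reals all_analysis.
From mathcomp Require Import lra.

Import Order.TTheory GRing.Theory Num.Theory.
Import numFieldNormedType.Exports.

Local Open Scope classical_set_scope.
Local Open Scope ring_scope.

(** Let d_i = J^{B_i} x - x, e_j = J^{F_j} (A_j x) - A_j x, and let S(x) be the
    sum of all |d_i|^2 and |e_j|^2. For z in Gamma, monotonicity gives
    <v, x - z> <= - S(x) for the direction v = sum_i d_i + sum_j A_j^* e_j, and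
    Cauchy-Schwarz gives |v|^2 <= L S(x). Hence one step decreases |x - z|^2 by
    at least gamma (2 - gamma L) S(x): the iteration is Fejer monotone with
    respect to Gamma, and S(x^k) tends to 0. Since the graph of a maximal
    monotone mapping is closed under weak-strong limits, every weak limit of x^k
    along a free ultrafilter lies in Gamma, and Opial's argument shows that
    there is only one such limit. *)

(** * Hilbert spaces *)

Section InnerProduct.
Context {R : realType} {H : hilbertType R}.
Implicit Types x y z : H.

Lemma innerC x y : inner x y = inner y x.
Proof. by rewrite hermC expr0 mul1r. Qed.

Lemma innerDl x y z : inner (x + y) z = inner x z + inner y z.
Proof. exact: linearDl. Qed.

Lemma innerDr x y z : inner x (y + z) = inner x y + inner x z.
Proof. exact: linearDr. Qed.

Lemma innerNl x y : inner (- x) y = - inner x y.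
Proof. exact: linearNl. Qed.

Lemma innerNr x y : inner x (- y) = - inner x y.
Proof. exact: linearNr. Qed.

Lemma innerZl a x y : inner (a *: x) y = a * inner x y.
Proof. exact: linearZl_LR. Qed.

Lemma innerZr a x y : inner x (a *: y) = a * inner x y.
Proof. by rewrite innerC innerZl innerC. Qed.

Lemma inner0l x : inner 0 x = 0.
Proof. exact: linear0l. Qed.

Lemma inner0r x : inner x 0 = 0.
Proof. exact: linear0r. Qed.

Definition innerE := (innerDl, innerDr, innerNl, innerNr, innerZl, innerZr,
  inner0l, inner0r).

Lemma innerxx_ge0 x : 0 <= inner x x.
Proof. by rewrite -sqr_norm_inner sqr_ge0. Qed.

Lemma innerxx_eq0 x : inner x x = 0 -> x = 0.
Proof.
by rewrite -sqr_norm_inner => /eqP; rewrite sqrf_eq0 normr_eq0 => /eqP.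
Qed.

Lemma inner_suml I (s : seq I) (P : pred I) (E : I -> H) y :
  inner (\sum_(i <- s | P i) E i) y = \sum_(i <- s | P i) inner (E i) y.
Proof. exact: linear_sumlz. Qed.

Lemma norm_inner_le x y : `|inner x y| <= `|x| * `|y|.
Proof.
have [->|y0] := eqVneq y 0; first by rewrite innerE !normr0 mulr0.
have Y : 0 < `|y| by rewrite normr_gt0.
(* The sign [s] treats both halves of the absolute value at once: the square norm of |y| x - s |x| y
   expands to 2 |x| |y| (|x| |y| - s <x, y>). *)
have key (s : R) : s ^+ 2 = 1 -> s * inner x y <= `|x| * `|y|.
  move=> s1; have := innerxx_ge0 (`|y| *: x - (s * `|x|) *: y).
  rewrite !innerE -!sqr_norm_inner (innerC y x) => h.
  have [->|x0] := eqVneq x 0; first by rewrite innerE normr0 mulr0 mul0r.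
  have X : 0 < `|x| by rewrite normr_gt0.
  rewrite -(ler_pM2l (mulr_gt0 X Y)); nra.
have := key 1 (expr1n _ _); have := key (-1).
by rewrite sqrrN expr1n ler_norml => /(_ erefl); lra.
Qed.

(** By polarization, joint continuity reduces to continuity of the norm. *)
Lemma cvg_inner T (F : set_system T) (FF : Filter F) (f g : T -> H) a b :
  f @ F --> a -> g @ F --> b -> (fun t => inner (f t) (g t)) @ F --> inner a b.
Proof.
have E (u v : H) : inner u v = 2^-1 * (`|u + v| ^+ 2 - `|u| ^+ 2 - `|v| ^+ 2).
  by rewrite !sqr_norm_inner !innerE (innerC v u); lra.
move=> fa gb; rewrite E; under eq_fun do rewrite E.
have sq (h : T -> H) c : h @ F --> c -> (fun t => `|h t| ^+ 2) @ F --> `|c| ^+ 2.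
  by move=> hc; rewrite expr2; under eq_fun do rewrite expr2;
    apply: cvgM; apply: cvg_norm.
by apply: cvgMr; apply: cvgB; [apply: cvgB|]; apply: sq => //; apply: cvgD.
Qed.

End InnerProduct.

Lemma cvgn_of_sqr_dist_le {R : realType} {V : completeNormedModType R}
    (u : nat -> V) (h : nat -> R) :
  h @ \oo --> 0 -> (forall n k, `|u n - u k| ^+ 2 <= h n + h k) ->
  cvgn u.
Proof.
move=> h0 uh; apply/cauchy_cvgP/cauchy_exP => e e0.
have e2 : 0 < e ^+ 2 / 2 by rewrite divr_gt0 ?exprn_gt0.
have [N _ hN] := cvgr0_norm_lt _ h0 _ e2.
exists (u N); exists N => // n /= Nn; rewrite -ball_normE /=.
rewrite -(ltr_pXn2r (n := 2)) ?nnegrE ?(ltW e0)//.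
have := uh N n; have := hN n Nn; have := hN N (leqnn N); rewrite /=.
by rewrite !ltr_norml; lra.
Qed.

(** * Minimization of convex functions plus half the squared norm *)

Section Minimization.
Context {R : realType} {H1 H2 : hilbertType R}.
(** A closed convex subset of H1 x H2 x R, given as a relation so that it may be the graph of a
    linear function (for Riesz) or an epigraph (for Minty). *)
Variable E : H1 -> H2 -> R -> Prop.
Hypothesis E_neq0 : exists z w t, E z w t.
Hypothesis E_convex : forall z w t z' w' t' (s : R), 0 <= s <= 1 ->
  E z w t -> E z' w' t' ->
  E (z + s *: (z' - z)) (w + s *: (w' - w)) (t + s * (t' - t)).
Hypothesis E_closed : forall (z : nat -> H1) (w : nat -> H2) (t : nat -> R) a b (c : R),
  (forall n, E (z n) (w n) (t n)) ->
  z @ \oo --> a -> w @ \oo --> b -> t @ \oo --> c -> E a b c.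

Let q (z : H1) (w : H2) (t : R) := t + (inner z z + inner w w) / 2.

Hypothesis E_lbound : exists m : R, forall z w t, E z w t -> m <= q z w t.

(** A minimizing sequence is Cauchy: by the parallelogram law, the value of [q] at a midpoint is at
    most the mean of the two values minus one eighth of the squared distance. *)
Lemma minimizer_exists :
  exists z w t, E z w t /\ forall z' w' t', E z' w' t' -> q z w t <= q z' w' t'.
Proof.
pose S := [set y : R | exists z w t, E z w t /\ y = q z w t].
have infS : has_inf S.
  split.
    by have [z [w [t ezwt]]] := E_neq0; exists (q z w t); exists z, w, t.
  by have [m hm] := E_lbound; exists m => _ [z [w [t [? ->]]]]; exact: hm.
have leS z w t : E z w t -> inf S <= q z w t.
  by move=> e; apply: ge_inf; [case: infS | exists z, w, t].
have ex n : exists v : H1 * H2 * R,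
    E v.1.1 v.1.2 v.2 /\ q v.1.1 v.1.2 v.2 < inf S + harmonic n.
  have [_ [z [w [t [e ->]]]] lt] := inf_adherent (harmonic_gt0 (R := R) n) infS.
  by exists (z, w, t).
have [v hv] := choice ex.
pose z n := (v n).1.1; pose w n := (v n).1.2; pose t n := (v n).2.
have zwE n : E (z n) (w n) (t n) by case: (hv n).
have qlt n : q (z n) (w n) (t n) < inf S + harmonic n by case: (hv n).
have dist n k : inner (z n - z k) (z n - z k) + inner (w n - w k) (w n - w k)
    <= 4 * harmonic n + 4 * harmonic k.
  have h2 : 0 <= (2^-1 : R) <= 1 by lra.
  have := leS _ _ _ (E_convex _ _ _ _ _ _ _ h2 (zwE n) (zwE k)).
  have := qlt n; have := qlt k; rewrite /q !innerE.
  rewrite (innerC (z k) (z n)) (innerC (w k) (w n)).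
  lra.
have h4 : (fun n => 4 * harmonic n : R) @ \oo --> 0.
  by rewrite -(mulr0 4); apply: cvgMr; exact: cvg_harmonic.
have cz : cvgn z.
  apply: cvgn_of_sqr_dist_le h4 _ => n k; rewrite sqr_norm_inner.
  by have := dist n k; have := innerxx_ge0 (w n - w k); lra.
have cw : cvgn w.
  apply: cvgn_of_sqr_dist_le h4 _ => n k; rewrite sqr_norm_inner.
  by have := dist n k; have := innerxx_ge0 (z n - z k); lra.
pose a := limn z; pose b := limn w.
have cq : (fun n => q (z n) (w n) (t n)) @ \oo --> inf S.
  apply: (@squeeze_cvgr _ _ _ _ (fun=> inf S) (fun n => inf S + harmonic n)).
  - by near=> n; rewrite leS //= ltW.
  - exact: cvg_cst.
  - rewrite -[X in _ --> X]addr0; apply: cvgD; first exact: cvg_cst.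
    exact: cvg_harmonic.
have cn : (fun n => (inner (z n) (z n) + inner (w n) (w n)) / 2) @ \oo -->
    (inner a a + inner b b) / 2.
  by apply: cvgMl; apply: cvgD; apply: cvg_inner.
(* The heights [t n] converge because [q] and the norms do. *)
have ct : t @ \oo --> inf S - (inner a a + inner b b) / 2.
  have -> : t = (fun n => q (z n) (w n) (t n) -
      (inner (z n) (z n) + inner (w n) (w n)) / 2).
    by apply: funext => n; rewrite /q addrK.
  exact: cvgB.
exists a, b, (inf S - (inner a a + inner b b) / 2); split.
  exact: E_closed zwE cz cw ct.
by move=> z' w' t' /leS; rewrite /q subrK.
Unshelve. all: end_near. Qed.

(** First-order optimality: the one-sided derivative of [q] at the minimizer, along the segment to
    any other point of [E], is nonnegative. *)
Lemma minimizer_variational :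
  exists z w t, E z w t /\ forall z' w' t', E z' w' t' ->
    t + inner z z + inner w w <= t' + inner z z' + inner w w'.
Proof.
have [z [w [t [e emin]]]] := minimizer_exists.
exists z, w, t; split=> // z' w' t' e'.
set l := t' + inner z z' + inner w w' - (t + inner z z + inner w w).
set c := (inner (z' - z) (z' - z) + inner (w' - w) (w' - w)) / 2.
have c0 : 0 <= c by rewrite divr_ge0// addr_ge0 ?innerxx_ge0.
have key (s : R) : 0 < s -> s <= 1 -> 0 <= l + s * c.
  move=> s0 s1; have s01 : 0 <= s <= 1 by rewrite ltW.
  have := emin _ _ _ (E_convex _ _ _ _ _ _ _ s01 e e').
  rewrite -(pmulr_rge0 _ s0) /q /l /c !innerE.
  by rewrite (innerC z' z) (innerC w' w); lra.
suff : 0 <= l by rewrite /l subr_ge0.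
rewrite leNgt; apply/negP => l0.
have c1 : 0 < 1 - l + c by lra.
(* For l < 0 this [s] lies in (0, 1] and gives l + s c = l (1 - l) / (1 - l + c) < 0. *)
have := key (- l / (1 - l + c)).
rewrite divr_gt0 ?oppr_gt0// ler_pdivrMr// mul1r => /(_ erefl).
have -> : - l <= 1 - l + c by lra.
move=> /(_ erefl); apply/negP; rewrite -ltNge.
by rewrite -(ltr_pM2r c1) mul0r mulrDl mulrAC divfK ?gt_eqF//; nra.
Qed.

End Minimization.

(** The representing vector minimizes |z|^2 / 2 - f z; testing the variational inequality at z + y
    and z - y gives the equality. *)
Theorem riesz_representation {R : realType} {H : hilbertType R} (f : H -> R) (M : R) :
  {morph f : x y / x + y} -> (forall a x, f (a *: x) = a * f x) ->
  (forall x, `|f x| <= M * `|x|) ->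
  exists z, forall x, f x = inner x z.
Proof.
move=> fD fZ fM.
have fN x : f (- x) = - f x by rewrite -scaleN1r fZ mulN1r.
have [] := @minimizer_variational R H H (fun z _ t => t = - f z).
- by exists 0, 0, (- f 0).
- by move=> z w t z' w' t' s _ -> ->; rewrite fD fZ fD fN; lra.
- move=> z w t a b c tE za _ tc; apply: (cvg_unique _ tc) => //.
  have -> : t = (fun n => - f (z n)) by apply: funext.
  have Mza : (fun n => M * `|z n - a|) @ \oo --> 0.
    rewrite -(mulr0 M) -(normr0 H) -(subrr a); apply: cvgMr; apply: cvg_norm.
    by apply: cvgB => //; exact: cvg_cst.
  apply: cvgN; apply: (@squeeze_cvgr _ _ _ _ (fun n => f a - M * `|z n - a|)
    (fun n => f a + M * `|z n - a|)).
  - near=> n; have := fM (z n - a); rewrite fD fN ler_norml; lra.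
  - by rewrite -[X in _ --> X]subr0; apply: cvgB => //; exact: cvg_cst.
  - by rewrite -[X in _ --> X]addr0; apply: cvgD => //; exact: cvg_cst.
- exists (- (M ^+ 2 / 2)) => z w t ->.
  have := fM z; rewrite -!sqr_norm_inner ler_norml => /andP[_ h].
  by have := sqr_ge0 (`|z| - M); have := sqr_ge0 `|w|; nra.
move=> z [w [_ [-> h]]]; exists z => y.
have := h (z - y) w _ erefl; have := h (z + y) w _ erefl.
by rewrite !fD fN !innerE (innerC y z); lra.
Unshelve. all: end_near. Qed.

(** Riesz applied to x |-> <A x, y> shows that [xget] does not fall back on its default. *)
Lemma adjointE {R : realType} {H1 H2 : hilbertType R} (A : {linear H1 -> H2}) :
  bounded_operator A -> forall x y, inner (A x) y = inner x (adjoint A y).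
Proof.
move=> [M AM] x y; rewrite /adjoint; case: xgetP => [z _ /(_ x)//|].
move=> nex; exfalso.
have [] := @riesz_representation _ _ (fun x => inner (A x) y) (M * `|y|).
- by move=> u v; rewrite linearD innerE.
- by move=> a u; rewrite linearZ innerE.
- move=> u; apply: (le_trans (norm_inner_le _ _)).
  by rewrite mulrAC ler_wpM2r.
by move=> z hz; apply: (nex z).
Qed.

(** * Maximal monotone mappings *)

Section MaximalMonotone.
Context {R : realType} {H : hilbertType R} {B : H -> set H}.
Hypothesis maxB : maximal_monotone B.

(** Adding the pair (x, u) to the graph keeps it monotone, so by maximality the pair is already
    there. *)
Lemma maximal_monotone_mem x u :
  (forall y v, B y v -> 0 <= inner (u - v) (x - y)) -> B x u.
Proof.
move=> rel; apply: contrapT => nB; case: maxB => monB /(_ (fun y v => B y v \/ (y = x /\ v = u))).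
apply; last first.
  split=> [[y v] /= ?|/(_ (x, u)) /=]; first by left.
  by move=> h; apply/nB/h; right.
move=> y y' v v' [yv|[-> ->]] [yv'|[-> ->]].
- exact: monB.
- by rewrite -opprB -(opprB x) innerNl innerNr opprK; exact: rel.
- exact: rel.
- by rewrite !subrr innerE.
Qed.

(* Simons-Zalinescu: [E] is the epigraph of the Fitzpatrick function of
   [lambda B - x], and the variational inequality at the minimizer [(z, w)] of
   [t + (|z|^2 + |w|^2) / 2] puts [(- w, - z)] in the graph, whence [w = - z]. *)
Theorem minty (lambda : R) x : 0 < lambda -> exists z u, B z u /\ z + lambda *: u = x.
Proof.
move=> l0; have [monB _] := maxB.
pose E (z w : H) (t : R) := forall y v, B y v ->
  inner z (lambda *: v - x) + inner y w - inner y (lambda *: v - x) <= t.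
have memB z w : (forall y v, B y v -> 0 <= inner (w - (lambda *: v - x)) (z - y)) ->
    exists2 u, B z u & w = lambda *: u - x.
  move=> rel; exists (lambda^-1 *: (w + x)); last first.
    by rewrite scalerA divff ?gt_eqF// scale1r addrK.
  apply: maximal_monotone_mem => y v yv.
  rewrite -(pmulr_rge0 _ l0) -innerZl scalerBr scalerA divff ?gt_eqF// scale1r.
  by have := rel _ _ yv; rewrite opprB addrCA addrA [x + w]addrC.
have EB z u : B z u -> E z (lambda *: u - x) (inner z (lambda *: u - x)).
  move=> zu y v yv; have := monB _ _ _ _ zu yv; rewrite -(pmulr_rge0 _ l0).
  by rewrite !innerE !(innerC z) !(innerC y); lra.
(* If t < <z, w>, then (z, w) is monotonically related to the graph of lambda B - x, hence lies on
   it, and [E] tested at that very point gives <z, w> <= t. *)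
have Ege z w t : E z w t -> inner z w <= t.
  move=> e; rewrite leNgt; apply/negP => lt.
  have [y v yv|u zu wE] := memB z w.
    by have := e _ _ yv; rewrite !innerE !(innerC w) !(innerC v) !(innerC x); lra.
  by have := e _ _ zu; rewrite -wE; lra.
have [||||z [w [t [e h]]]] := @minimizer_variational R H H E.
- have [[y [v yv]]|nB] := pselect (exists y v, B y v).
    by exists y, (lambda *: v - x), (inner y (lambda *: v - x)); exact: EB.
  by exists 0, 0, 0 => y v yv; exfalso; apply: nB; exists y, v.
- move=> z w t z' w' t' s /andP[s0 s1] e e' y v yv.
  have := e _ _ yv; have := e' _ _ yv; rewrite !innerE; nra.
- move=> z w t a b c e za wb tc y v yv.
  apply: (ler_cvg_to _ tc); last by apply: nearW => n; exact: e yv.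
  by apply: cvgB; [apply: cvgD|exact: cvg_cst]; apply: cvg_inner => //; exact: cvg_cst.
- exists 0 => z w t /Ege; have := innerxx_ge0 (z + w).
  by rewrite !innerE (innerC w z); lra.
have zwt := Ege _ _ _ e.
have hB y v : B y v -> t + inner z z + inner w w <=
    inner y (lambda *: v - x) + inner z y + inner w (lambda *: v - x).
  by move=> /EB /h.
(* Adding <z, w> to [hB] and using <z, w> <= t bounds the required product below by |z + w|^2. *)
have [y v yv|u wu zE] := memB (- w) (- z).
  have := hB _ _ yv; have := innerxx_ge0 (z + w).
  move: (lambda *: v - x) => v'.
  by rewrite !innerE (innerC w z) (innerC v' y) (innerC v' w); lra.
have : inner (z + w) (z + w) = 0.
  apply/le_anti; rewrite innerxx_ge0 andbT.
  by have := hB _ _ wu; rewrite -zE !innerE (innerC w z); lra.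
move=> /innerxx_eq0 /eqP; rewrite addr_eq0 => /eqP zw.
exists z, u; split; first by rewrite zw.
by rewrite -[lambda *: u](subrK x) -zE addrA subrr add0r.
Qed.

Lemma resolvent_mem (lambda : R) x : 0 < lambda ->
  B (resolvent lambda B x) (lambda^-1 *: (x - resolvent lambda B x)).
Proof.
move=> l0; rewrite /resolvent; case: xgetP => [z _ [u zu <-]|nex].
  by rewrite addrAC subrr add0r scalerA mulVf ?gt_eqF// scale1r.
have [z [u [zu zuE]]] := minty _ x l0.
by exfalso; apply: (nex z); exists u.
Qed.

(** The graph point is split as base point plus displacement, the form in which
    [maximal_monotone_demiclosed] expects it. *)
Lemma resolvent_sub_mem (lambda : R) x : 0 < lambda ->
  B (x + (resolvent lambda B x - x)) (- (lambda^-1 *: (resolvent lambda B x - x))).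
Proof. by move=> l0; rewrite addrC subrK -scalerN opprB; exact: resolvent_mem. Qed.

Lemma inner_resolvent_sub_le (lambda : R) x z : 0 < lambda -> B z 0 ->
  inner (resolvent lambda B x - x) (x - z) <= - `|resolvent lambda B x - x| ^+ 2.
Proof.
move=> l0 Bz; have := resolvent_sub_mem lambda x l0.
set d := resolvent lambda B x - x => Bd.
have [monB _] := maxB; have := monB _ _ _ _ Bd Bz.
rewrite subr0 innerNl innerZl oppr_ge0 pmulr_rle0 ?invr_gt0//.
by rewrite addrAC addrC innerDr sqr_norm_inner; lra.
Qed.

End MaximalMonotone.

(** Monotonicity against each graph point (y, v) passes to the limit: boundedness of [a] makes <d,
    a> vanish, leaving <l, v> <= <y, v>. A general filter allows limits along ultrafilters. *)
Lemma maximal_monotone_demiclosed {R : realType} {H : hilbertType R} {B : H -> set H}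
    {F : set_system nat} {FF : ProperFilter F} (a d : nat -> H) (l : H) (C lambda : R) :
  maximal_monotone B ->
  (forall t, `|a t| <= C) -> (forall y, (fun t => inner (a t) y) @ F --> inner l y) ->
  d @ F --> 0 -> (forall t, B (a t + d t) (- (lambda *: d t))) -> B l 0.
Proof.
move=> maxB aC al d0 Bad; apply: (maximal_monotone_mem maxB) => y v yv.
have da0 : (fun t => inner (d t) (a t)) @ F --> 0.
  have nd0 : (fun t => C * `|d t|) @ F --> 0.
    by rewrite -(mulr0 C) -(normr0 H); apply: cvgMr; apply: cvg_norm.
  apply: (@squeeze_cvgr _ _ _ _ (fun t => - (C * `|d t|)) (fun t => C * `|d t|)) => //.
    near=> t; rewrite -ler_norml; apply: le_trans (norm_inner_le _ _) _.
    by rewrite mulrC ler_wpM2r.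
  by rewrite -oppr0; apply: cvgN.
have dy0 : (fun t => inner (d t) (d t - y)) @ F --> inner 0 (0 - y).
  by apply: cvg_inner => //; apply: cvgB => //; exact: cvg_cst.
have dv0 : (fun t => inner (d t) v) @ F --> inner 0 v.
  by apply: cvg_inner => //; exact: cvg_cst.
have cv : (fun t => lambda * (inner (d t) (a t) + inner (d t) (d t - y)) +
      (inner (a t) v + inner (d t) v)) @ F -->
    lambda * (0 + inner 0 (0 - y)) + (inner l v + inner 0 v).
  by apply: cvgD; [apply: cvgMr; apply: cvgD|apply: cvgD].
have := ler_cvg_to cv (cvg_cst (inner y v)).
rewrite !innerE (innerC v) (innerC v) => h.
suff : inner l v <= inner y v by lra.
have : lambda * (0 + 0) + (inner l v + 0) <= inner y v.
  apply: h; near=> t; have [monB _] := maxB; have := monB _ _ _ _ (Bad t) yv.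
  by rewrite !innerE (innerC v) (innerC v) (innerC v); lra.
by lra.
Unshelve. all: end_near. Qed.

(** * Weak convergence *)

(** Compactness of [-C, C] gives a cluster point, and an ultrafilter converges to its cluster
    points. *)
Lemma ultra_cvg_bounded {R : realType} {T} {U : set_system T} {FU : UltraFilter U}
    (g : T -> R) (C : R) : (forall t, `|g t| <= C) -> exists p : R, g @ U --> p.
Proof.
move=> gC.
have [|p [_ pcl]] := @segment_compact R (- C) C (g @ U) _.
  by apply: nearW => t /=; rewrite in_itv /= -ler_norml.
exists p => V pV; have [//|UnV] := in_ultra_setVsetC (g @^-1` V) FU.
have [r [/= rV Vr]] : (~` V) `&` V !=set0 by apply: pcl.
by [].
Qed.

(** Weak compactness of balls without subsequences: the limit of <a t, y> is linear in y and bounded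
    by C |y|, so Riesz supplies [l]. *)
Lemma ultra_weak_cvg {R : realType} {H : hilbertType R} {U : set_system nat}
    {FU : UltraFilter U} (a : nat -> H) (C : R) : (forall t, `|a t| <= C) ->
  exists l, forall y, (fun t => inner (a t) y) @ U --> inner l y.
Proof.
move=> aC.
have bnd y t : `|inner (a t) y| <= C * `|y|.
  by apply: le_trans (norm_inner_le _ _) _; rewrite ler_wpM2r.
have [f fE] := choice (fun y => ultra_cvg_bounded _ _ (bnd y)).
have uniq (g : nat -> R) (p q : R) : g @ U --> p -> g @ U --> q -> p = q.
  by move=> gp gq; exact: (cvg_unique (@Rhausdorff R) gp gq).
have [|||z fz] := @riesz_representation _ _ f C.
- move=> x y; apply: uniq (fE (x + y)) _; under eq_fun do rewrite innerE.
  exact: cvgD.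
- move=> b x; apply: uniq (fE (b *: x)) _; under eq_fun do rewrite innerE.
  exact: cvgMr.
- move=> y; apply: (ler_cvg_to (cvg_norm (fE y)) (cvg_cst (C * `|y|))).
  by apply: nearW => t.
by exists z => y; rewrite innerC -fz.
Qed.

(** * Fejer monotone sequences *)

Section Fejer.
Context {R : realType} {H : hilbertType R}.
Variables (x : nat -> H) (G : set H).
Hypothesis G_neq0 : G !=set0.
Hypothesis fejer : forall z k, G z -> `|x k.+1 - z| <= `|x k - z|.

Lemma fejer_le z k : G z -> `|x k - z| <= `|x 0%N - z|.
Proof. by move=> Gz; elim: k => // k; apply: le_trans; exact: fejer. Qed.

Lemma fejer_bounded : exists C, forall k, `|x k| <= C.
Proof.
have [z Gz] := G_neq0; exists (`|x 0%N - z| + `|z|) => k.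
by rewrite -[x k](subrK z) (le_trans (ler_normD _ _))// lerD2r fejer_le.
Qed.

Lemma fejer_cvg z : G z -> cvgn (fun k => `|x k - z| ^+ 2).
Proof.
move=> Gz; apply: nonincreasing_is_cvgn.
  apply/nonincreasing_seqP => k; rewrite lerXn2r ?nnegrE//; exact: fejer.
by exists 0 => _ [k _ <-]; rewrite sqr_ge0.
Qed.

(* Opial: [|x k - l|^2 - |x k - l'|^2] converges, and its limits along two
   ultrafilters with weak limits [l] and [l'] differ by [2 |l - l'|^2]. *)
Lemma fejer_weak_cvg :
  (forall (U : set_system nat) l, UltraFilter U -> \oo `<=` U ->
    (forall y, (fun k => inner (x k) y) @ U --> inner l y) -> G l) ->
  exists2 l, G l & weak_cvg x l.
Proof.
move=> Glim; have [C xC] := fejer_bounded.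
have [U [ultraU ooU]] := @ultraFilterLemma nat \oo _.
have [l xl] := ultra_weak_cvg _ _ xC.
have Gl := Glim _ _ ultraU ooU xl.
exists l => // y V yV; apply: contrapT => nV.
(* If convergence fails at [y], the indices outside [N] meet every tail, so an ultrafilter [W] finer
   than [\oo] contains their set. Its weak limit [l'] equals [l], which puts [N] in [W] as well. *)
pose N := (fun k => inner (x k) y) @^-1` V.
have PF : ProperFilter (within (~` N) \oo).
  split; last exact: within_filter.
  move=> h; apply: nV; apply: (@filterS nat \oo _ (fun k => (~` N) k -> set0 k) N _ h).
  by move=> k; exact: contrapT.
have [W [ultraW WN]] := ultraFilterLemma PF.
have ooW : \oo `<=` W by move=> P ooP; apply/WN; apply: filterS ooP.
have nNW : W (~` N) by apply: WN; exact: withinT.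
have [l' xl'] := @ultra_weak_cvg _ _ W _ _ _ xC.
have Gl' := Glim _ _ ultraW ooW xl'.
suff ll' : l' = l.
  have NW : W N by apply: xl'; rewrite ll'.
  by have [k []] := filter_ex (filterI NW nNW).
have xE k : inner (x k) (l - l') = 2^-1 * (`|x k - l'| ^+ 2 - `|x k - l| ^+ 2 -
    inner l' l' + inner l l).
  by rewrite !sqr_norm_inner !innerE (innerC l') (innerC l); lra.
have cx : cvgn (fun k => inner (x k) (l - l')).
  under eq_fun do rewrite xE.
  apply: is_cvgMr; apply: is_cvgD; last exact: is_cvg_cst.
  apply: is_cvgB; last exact: is_cvg_cst.
  by apply: is_cvgB; exact: fejer_cvg.
have eql : inner l (l - l') = limn (fun k => inner (x k) (l - l')).
  by apply: (cvg_unique _ (xl _)) => //; exact: cvg_trans (cvg_app _ ooU) cx.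
have eql' : inner l' (l - l') = limn (fun k => inner (x k) (l - l')).
  by apply: (cvg_unique _ (xl' _)) => //; exact: cvg_trans (cvg_app _ ooW) cx.
apply/esym/subr0_eq/innerxx_eq0.
by rewrite innerDl eql innerNl eql' subrr.
Qed.

End Fejer.

(** * The iteration *)

Section OperatorNorm.
Context {R : realType} {H1 H2 : hilbertType R} (A : {linear H1 -> H2}).
Hypothesis bA : bounded_operator A.

Lemma operator_norm_ub x : `|x| <= 1 -> `|A x| <= operator_norm A.
Proof.
have [M AM] := bA.
move=> x1; apply: ub_le_sup; last by exists x.
(* [M] itself can be negative when [H1] is the zero space. *)
exists `|M| => _ [y /= y1 <-]; apply: le_trans (AM y) _.
rewrite (le_trans (ler_norm _))// normrM normr_id.
by rewrite -[leRHS]mulr1 ler_wpM2l.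
Qed.

Lemma operator_norm_ge0 : 0 <= operator_norm A.
Proof. by rewrite (le_trans _ (operator_norm_ub 0 _))// normr0. Qed.

Lemma norm_le_operator_norm x : `|A x| <= operator_norm A * `|x|.
Proof.
have [->|x0] := eqVneq x 0; first by rewrite linear0 !normr0 mulr0.
have X : 0 < `|x| by rewrite normr_gt0.
rewrite -ler_pdivrMr// mulrC -[X in X * _]gtr0_norm ?invr_gt0// -normrZ -linearZ.
by apply: operator_norm_ub; rewrite normrZ gtr0_norm ?invr_gt0// mulVf ?gt_eqF.
Qed.

(** For z = A^* y, |z|^2 = <A z, y> <= |A| |z| |y|; then divide by |z|. *)
Lemma sqr_norm_adjoint_le (y : H2) :
  `|adjoint A y| ^+ 2 <= operator_norm A ^+ 2 * `|y| ^+ 2.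
Proof.
set z := adjoint A y.
have zz : `|z| ^+ 2 <= `|A z| * `|y|.
  rewrite sqr_norm_inner -adjointE//; apply: le_trans (norm_inner_le _ _).
  exact: ler_norm.
have Az := norm_le_operator_norm z.
have [->|z0] := eqVneq z 0; first by rewrite normr0 expr0n mulr_ge0 ?sqr_ge0.
have Z : 0 < `|z| by rewrite normr_gt0.
have zy : `|z| <= operator_norm A * `|y|.
  rewrite -(ler_pM2l Z) -expr2 (le_trans zz)// mulrA [`|z| * _]mulrC.
  by rewrite ler_wpM2r.
by rewrite -exprMn lerXn2r ?nnegrE// (le_trans _ zy)// ltW.
Qed.

End OperatorNorm.

(* Cauchy-Schwarz in a form that is closed under addition of the triples
   [(u, c, b)], so that it passes to finite sums. *)
Lemma sqr_normD_le {R : realType} {H : hilbertType R} (u v : H) (c b c' b' : R) :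
  0 <= c -> 0 <= b -> 0 <= c' -> 0 <= b' ->
  `|u| ^+ 2 <= c * b -> `|v| ^+ 2 <= c' * b' ->
  `|u + v| ^+ 2 <= (c + c') * (b + b').
Proof.
move=> c0 b0 c0' b0' ub vb.
(* Arithmetic-geometric mean inequality for c b' and c' b, after squaring. *)
have uv : `|u| * `|v| *+ 2 <= c * b' + c' * b.
  rewrite -(ler_pXn2r (n := 2)) ?nnegrE ?mulrn_wge0 ?addr_ge0 ?mulr_ge0//.
  have h : `|u| ^+ 2 * `|v| ^+ 2 <= (c * b) * (c' * b').
    by rewrite ler_pM ?sqr_ge0.
  have := sqr_ge0 (c * b' - c' * b); move: h; rewrite -mulr_natl; nra.
have : `|u + v| ^+ 2 <= (`|u| + `|v|) ^+ 2.
  by rewrite lerXn2r ?nnegrE ?addr_ge0// ler_normD.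
by rewrite sqrrD; lra.
Qed.

Lemma sqr_norm_sum_le {R : realType} {H : hilbertType R} (I : Type) (s : seq I)
    (u : I -> H) (c b : I -> R) :
  (forall i, 0 <= c i) -> (forall i, 0 <= b i) ->
  (forall i, `|u i| ^+ 2 <= c i * b i) ->
  `|\sum_(i <- s) u i| ^+ 2 <= (\sum_(i <- s) c i) * \sum_(i <- s) b i.
Proof.
move=> c0 b0 ub; elim: s => [|i s IH]; first by rewrite !big_nil normr0 expr0n mul0r.
by rewrite !big_cons sqr_normD_le ?sumr_ge0.
Qed.

Section Iteration.
Context {R : realType} {H1 H2 : hilbertType R} {p r : nat}.
Variables (B : 'I_p -> H1 -> set H1) (F : 'I_r -> H2 -> set H2)
  (A : 'I_r -> {linear H1 -> H2}).
Hypotheses (hB : forall i, maximal_monotone (B i))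
  (hF : forall j, maximal_monotone (F j))
  (hA : forall j, bounded_operator (A j)).
Variable lambda : R.
Hypothesis lambda_gt0 : 0 < lambda.

(** [Bres], [Fres], [direction] and [residual] are the d_i, e_j, v and S of the overview. *)
Definition Bres i (x : H1) := resolvent lambda (B i) x - x.
Definition Fres j (x : H1) := resolvent lambda (F j) (A j x) - A j x.

Definition direction (x : H1) :=
  \sum_(i < p) Bres i x + \sum_(j < r) adjoint (A j) (Fres j x).

Definition residual (x : H1) :=
  \sum_(i < p) `|Bres i x| ^+ 2 + \sum_(j < r) `|Fres j x| ^+ 2.

Let L := p%:R + \sum_(j < r) operator_norm (A j) ^+ 2.

Lemma residual_ge0 x : 0 <= residual x.
Proof. by rewrite addr_ge0// sumr_ge0// => i _; rewrite sqr_ge0. Qed.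

Lemma Bres_le i x : `|Bres i x| ^+ 2 <= residual x.
Proof.
rewrite /residual (bigD1 i)//= -addrA lerDl addr_ge0// sumr_ge0// => k _;
by rewrite sqr_ge0.
Qed.

Lemma Fres_le j x : `|Fres j x| ^+ 2 <= residual x.
Proof.
rewrite /residual addrC (bigD1 j)//= -addrA lerDl addr_ge0// sumr_ge0// => k _;
by rewrite sqr_ge0.
Qed.

(** Weighted Cauchy-Schwarz, with weight 1 for each d_i and |A_j|^2 for each e_j; the weights add up
    to [L]. *)
Lemma sqr_norm_direction_le x : `|direction x| ^+ 2 <= L * residual x.
Proof.
have -> : L = \sum_(i < p) 1 + \sum_(j < r) operator_norm (A j) ^+ 2.
  by rewrite sumr_const card_ord.
apply: sqr_normD_le; try by apply: sumr_ge0 => i _; rewrite ?sqr_ge0.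
- by apply: sqr_norm_sum_le => i; rewrite ?sqr_ge0 ?mul1r.
- apply: sqr_norm_sum_le => j; rewrite ?sqr_ge0 //.
  exact: sqr_norm_adjoint_le.
Qed.

(** Moving A_j^* across the inner product reduces each term to the resolvent estimate, at the zero z
    of B_i or A_j z of F_j. *)
Lemma inner_direction_le x z : common_null_points B F A z ->
  inner (direction x) (x - z) <= - residual x.
Proof.
move=> [Bz Fz]; rewrite innerDl !inner_suml opprD -!sumrN lerD//.
  by apply: ler_sum => i _; apply: inner_resolvent_sub_le.
apply: ler_sum => j _; rewrite innerC -adjointE// innerC [A j (x - z)]linearB.
exact: inner_resolvent_sub_le.
Qed.

Lemma step_le (gamma : R) x z : 0 <= gamma -> common_null_points B F A z ->
  `|x + gamma *: direction x - z| ^+ 2 <=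
  `|x - z| ^+ 2 - gamma * (2 - gamma * L) * residual x.
Proof.
move=> g0 Gz; have := inner_direction_le x z Gz; have := sqr_norm_direction_le x.
rewrite addrAC; move: (x - z) (direction x) => y v hv hy.
have := ler_wpM2l g0 hy; have := ler_wpM2l (sqr_ge0 gamma) hv.
by rewrite !sqr_norm_inner !innerE (innerC y v); lra.
Qed.

End Iteration.

Theorem mainTheorem2 (R : realType) (H1 H2 : hilbertType R)
    (p r : nat) (hp : (1 <= p)%N) (hr : (1 <= r)%N)
    (B : 'I_p -> H1 -> set H1) (F : 'I_r -> H2 -> set H2)
    (A : 'I_r -> {linear H1 -> H2})
    (hB : forall i, maximal_monotone (B i))
    (hF : forall j, maximal_monotone (F j))
    (hA : forall j, bounded_operator (A j))
    (lambda gamma : R) (hlambda : 0 < lambda)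
    (hgamma0 : 0 < gamma)
    (hgamma : gamma < 2 / (p%:R + \sum_(j < r) operator_norm (A j) ^+ 2))
    (hGamma : common_null_points B F A !=set0)
    (x0 : H1) (x : nat -> H1) (hx0 : x 0%N = x0)
    (hx : forall k : nat,
      x k.+1 = x k + gamma *:
        (\sum_(i < p) (resolvent lambda (B i) (x k) - x k) +
         \sum_(j < r) adjoint (A j)
                        (resolvent lambda (F j) (A j (x k)) - A j (x k)))) :
  exists2 xstar : H1, common_null_points B F A xstar & weak_cvg x xstar.
Proof.
have L0 : 0 < p%:R + \sum_(j < r) operator_norm (A j) ^+ 2.
  by rewrite ltr_wpDr ?ltr0n// sumr_ge0// => j _; rewrite sqr_ge0.
set c := gamma * (2 - gamma * (p%:R + \sum_(j < r) operator_norm (A j) ^+ 2)).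
have c0 : 0 < c by rewrite mulr_gt0// subr_gt0 -ltr_pdivlMr.
pose S k := residual B F A lambda (x k).
have step z k : common_null_points B F A z ->
    `|x k.+1 - z| ^+ 2 <= `|x k - z| ^+ 2 - c * S k.
  by move=> Gz; rewrite hx; apply: step_le => //; exact: ltW.
have S0 k : 0 <= S k by exact: residual_ge0.
have fejer z k : common_null_points B F A z -> `|x k.+1 - z| <= `|x k - z|.
  move=> Gz; rewrite -(ler_pXn2r (n := 2)) ?nnegrE// (le_trans (step z k Gz))//.
  by rewrite gerBl mulr_ge0 ?(ltW c0).
(* c S k is at most the difference of consecutive terms of the convergent sequence |x k - z|^2. *)
have Scvg : S @ \oo --> 0.
  have [z Gz] := hGamma.
  have cz := fejer_cvg x _ fejer z Gz.
  have cz1 : (fun k => `|x k.+1 - z| ^+ 2) @ \oo --> limn (fun k => `|x k - z| ^+ 2).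
    by rewrite (cvg_shiftS (fun k => `|x k - z| ^+ 2)).
  apply: (@squeeze_cvgr _ _ _ _ (fun=> 0)
    (fun k => c^-1 * (`|x k - z| ^+ 2 - `|x k.+1 - z| ^+ 2))).
  - by apply: nearW => k; rewrite S0 /= ler_pdivlMl//; have := step z k Gz; lra.
  - exact: cvg_cst.
  - rewrite -(mulr0 c^-1) -(subrr (limn (fun k => `|x k - z| ^+ 2))).
    by apply: cvgMr; apply: cvgB.
(* Stated for any [H], since it serves the displacements in [H1] and in [H2]. *)
have res0 (H : hilbertType R) (d : nat -> H) :
    (forall k, `|d k| ^+ 2 <= S k) -> d @ \oo --> 0.
  move=> dS; apply/cvgr0Pnorm_lt => e e0.
  have /cvgr0Pnorm_lt/(_ _ (exprn_gt0 2 e0)) := Scvg.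
  apply: filterS => k; rewrite ger0_norm// => Sk.
  rewrite -(ltr_pXn2r (n := 2)) ?nnegrE ?(ltW e0)//.
  exact: le_lt_trans (dS k) Sk.
apply: (fejer_weak_cvg x _ hGamma fejer) => U l ultraU ooU xl.
have [C xC] := fejer_bounded x _ hGamma fejer.
split=> [i|j].
  apply: (maximal_monotone_demiclosed (F := U) x (fun k => Bres B lambda i (x k))
    l C lambda^-1 (hB i) xC xl).
    apply: cvg_trans (cvg_app _ ooU) _; apply: res0 => k.
    exact: Bres_le.
  by move=> k; apply: resolvent_sub_mem.
(* [A j] preserves weak limits, because <A_j x, y> = <x, A_j^* y>, and its operator norm carries the
   bound [C] over to [H2]. *)
apply: (maximal_monotone_demiclosed (F := U) (fun k => A j (x k))
  (fun k => Fres F A lambda j (x k)) (A j l) (operator_norm (A j) * C) lambda^-1 (hF j)).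
- move=> k; apply: le_trans (norm_le_operator_norm _ (hA j) _) _.
  by rewrite ler_wpM2l// operator_norm_ge0.
- move=> y; rewrite adjointE//; under eq_fun do rewrite adjointE//.
  exact: xl.
- apply: cvg_trans (cvg_app _ ooU) _; apply: res0 => k.
  exact: Fres_le.
- by move=> k; apply: resolvent_sub_mem.
Qed.
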